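(* Let $\alpha>0$ and let $m\ge0$ be an integer. As $j\to\infty$, the $m$ zeros of $L^{\mathrm{I}(\alpha)}_{m,m+j}$ in $(-\infty,0)$ converge to the $m$ zeros of the polynomial $z\mapsto L^{(\alpha-1)}_m(-z)$; that is, if $y_{j,1}<\dots<y_{j,m}$ are the zeros of $L^{\mathrm{I}(\alpha)}_{m,m+j}$ in $(-\infty,0)$ and $w_1<\dots<w_m$ are the zeros of $L^{(\alpha-1)}_m(-z)$, then $\lim_{j\to\infty}y_{j,i}=w_i$ for $i=1,\dots,m$.
   Context: For real $\alpha$ and integer $n\ge 0$, $L^{(\alpha)}_n(z)=\sum_{k=0}^n \binom{n+\alpha}{n-k}\frac{(-z)^k}{k!}$ is the classical Laguerre polynomial (generalized binomial coefficients). Put $\xi_{\alpha,m}(z)=L^{(\alpha)}_m(-z)$ and $A^{\mathrm{I}}_{\alpha,m}[y]=\xi_{\alpha,m}\,y'-\xi_{\alpha+1,m}\,y$. The type I exceptional ($X_m$-)Laguerre polynomials are $L^{\mathrm{I}(\alpha)}_{m,m+j}=-A^{\mathrm{I}}_{\alpha-1,m}\big[L^{(\alpha-1)}_j\big]=\xi_{\alpha,m}L^{(\alpha-1)}_j-\xi_{\alpha-1,m}\,\big(L^{(\alpha-1)}_j\big)'$, $j=0,1,2,\dots$. For $\alpha>0$, $L^{\mathrm{I}(\alpha)}_{m,m+j}$ has exactly $m$ zeros in $(-\infty,0)$, all simple; the zeros of $L^{(\alpha-1)}_m(-z)$ are real, negative and simple. *)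

(* Defs.v *)
From HB Require Import structures.
From mathcomp Require Import all_boot all_order all_algebra.
From mathcomp Require Import all_classical all_reals all_analysis.

Set Implicit Arguments.
Unset Strict Implicit.
Unset Printing Implicit Defensive.

Import Order.TTheory GRing.Theory Num.Theory.
Import numFieldNormedType.Exports.
Local Open Scope classical_set_scope.
Local Open Scope ring_scope.

(* Generalized binomial coefficient x (x - 1) ... (x - k + 1) / k!. *)
Definition gbinom (R : realType) (x : R) (k : nat) : R :=
  (\prod_(i < k) (x - i%:R)) / k`!%:R.

Definition laguerre (R : realType) (a : R) (n : nat) : {poly R} :=
  \sum_(k < n.+1) (gbinom (n%:R + a) (n - k) / k`!%:R) *: (- 'X) ^+ k.

Definition xi (R : realType) (a : R) (m : nat) : {poly R} :=
  laguerre a m \Po (- 'X).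

Definition opAI (R : realType) (a : R) (m : nat) (y : {poly R}) : {poly R} :=
  xi a m * y^`() - xi (a + 1) m * y.

(* [xlaguerreI a m j] is L^{I(a)}_{m,m+j}: the argument [j] is the degree of
   the seed Laguerre polynomial, not the second index m + j. *)
Definition xlaguerreI (R : realType) (a : R) (m j : nat) : {poly R} :=
  - opAI (a - 1) m (laguerre (a - 1) j).

Lemma xlaguerreIE (R : realType) (a : R) (m j : nat) :
  xlaguerreI a m j =
  xi a m * laguerre (a - 1) j - xi (a - 1) m * (laguerre (a - 1) j)^`().
Proof. by rewrite /xlaguerreI /opAI opprB subrK. Qed.

Definition increasing_enum (R : realType) (n : nat) (A : set R)
    (z : 'I_n -> R) : Prop :=
  (forall i k : 'I_n, (i < k)%N -> z i < z k) /\ range z = A.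

(* Main.v *)
(* Write X_j for xlaguerreI a m j. The polynomials p_j = xi (a - 1) j have
   positive coefficients, and p_j(t) / p_j'(t) tends to 0 for every t > 0. As
   L^{(a-1)}_j(x) = p_j(- x), we have
     X_j(x) = xi_a(x) p_j(- x) + xi_{a-1}(x) p_j'(- x),
   so X_j(x) / p_j'(- x) tends to xi_{a-1}(x), pointwise in x < 0. All m roots
   w_i of xi_{a-1} being simple, X_j eventually changes sign between w_i - e
   and w_i + e; as X_j has only m negative roots, these are y_{j,1} < ... <
   y_{j,m}, one in each of the m disjoint intervals. *)
Require Import Defs.
From mathcomp Require Import all_boot all_order all_algebra.
From mathcomp Require Import all_classical all_reals all_analysis.
From mathcomp Require Import ring lra.

Import Order.TTheory GRing.Theory Num.Theory.
Import numFieldNormedType.Exports.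
Local Open Scope classical_set_scope.
Local Open Scope ring_scope.

(** * Coefficients of [xi] *)

Lemma gbinomS (R : realType) (x : R) (k : nat) :
  gbinom x k.+1 = gbinom x k * ((x - k%:R) / k.+1%:R).
Proof.
rewrite /gbinom big_ord_recr /= factS natrM.
by field; rewrite nat1r !pnatr_eq0 /= -lt0n fact_gt0.
Qed.

Lemma gbinom_gt0 (R : realType) (x : R) (k : nat) :
  k%:R - 1 < x -> 0 < gbinom x k.
Proof.
move=> kx; rewrite divr_gt0 ?ltr0n ?fact_gt0 //.
apply: prodr_gt0 => i _; rewrite subr_gt0; apply: le_lt_trans kx.
by rewrite lerBrDr natr1 ler_nat.
Qed.

Lemma xiE (R : realType) (b : R) (n : nat) :
  xi b n = \poly_(k < n.+1) (gbinom (n%:R + b) (n - k) / k`!%:R).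
Proof.
rewrite /xi /laguerre linear_sum poly_def; apply: eq_bigr => k _ /=.
by rewrite comp_polyZ rmorphXn /= rmorphN /= comp_polyX opprK.
Qed.

Lemma coef_xi (R : realType) (b : R) (n k : nat) : (xi b n)`_k =
  if (k <= n)%N then gbinom (n%:R + b) (n - k) / k`!%:R else 0.
Proof. by rewrite xiE coef_poly ltnS. Qed.

Lemma coef_xi_gt0 (R : realType) (b : R) (n k : nat) :
  -1 < b -> (k <= n)%N -> 0 < (xi b n)`_k.
Proof.
move=> b_gtN1 kn; rewrite coef_xi kn divr_gt0 ?ltr0n ?fact_gt0 //.
apply: gbinom_gt0; have : (n - k)%:R <= n%:R :> R by rewrite ler_nat leq_subr.
lra.
Qed.

Lemma coef_xi_ge0 (R : realType) (b : R) (n k : nat) :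
  -1 < b -> 0 <= (xi b n)`_k.
Proof.
move=> b_gtN1; case: (leqP k n) => [kn|nk]; first by rewrite ltW ?coef_xi_gt0.
by rewrite coef_xi leqNgt nk.
Qed.

Lemma size_xi (R : realType) (b : R) (n : nat) : -1 < b -> size (xi b n) = n.+1.
Proof.
move=> b_gtN1; rewrite xiE size_poly_eq //.
by have := coef_xi_gt0 _ b n n b_gtN1 (leqnn n); rewrite coef_xi leqnn => /lt0r_neq0.
Qed.

(** Follows from [gbinomS], since binomials with lower indices n - k and n - k - 1 differ by the
    factor (b + k + 1) / (n - k). For fixed k this factor tends to 0 as n grows. *)
Lemma coef_xi_step (R : realType) (b : R) (n k : nat) :
  -1 < b -> (k < n)%N ->
  (xi b n)`_k = ((b + k.+1%:R) / (n - k)%:R) * ((xi b n)^`())`_k.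
Proof.
move=> b_gtN1 kn; rewrite coef_deriv !coef_xi kn (ltnW kn).
rewrite -(subnSK kn) gbinomS.
have -> : n%:R + b - (n - k.+1)%:R = b + k.+1%:R :> R by rewrite natrB//; ring.
rewrite factS natrM -mulr_natr; field.
by rewrite !nat1r !pnatr_eq0 /= -lt0n fact_gt0.
Qed.

(** * Comparison of [xi] with its derivative on the positive axis *)

Lemma horner_ge0 (R : realType) (p : {poly R}) (t : R) :
  (forall k, 0 <= p`_k) -> 0 <= t -> 0 <= p.[t].
Proof.
move=> p0 t0; rewrite horner_coef sumr_ge0 // => k _.
by rewrite mulr_ge0 ?exprn_ge0.
Qed.

Lemma horner_gt0 (R : realType) (p : {poly R}) (t : R) :
  (forall k, 0 <= p`_k) -> 0 < p`_0 -> 0 <= t -> 0 < p.[t].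
Proof.
move=> p0 p00 t0; have sp : (0 < size p)%N.
  by rewrite lt0n size_poly_eq0; apply: contraTneq p00 => ->; rewrite coef0 ltxx.
rewrite horner_coef -(prednK sp) big_ord_recl expr0 mulr1 ltr_wpDr //.
by rewrite sumr_ge0 // => k _; rewrite mulr_ge0 ?exprn_ge0.
Qed.

Lemma deriv_xi_gt0 (R : realType) (b : R) (n : nat) (t : R) :
  -1 < b -> (0 < n)%N -> 0 <= t -> 0 < (xi b n)^`().[t].
Proof.
move=> b_gtN1 n0; apply: horner_gt0 => [k|].
  by rewrite coef_deriv mulrn_wge0 ?coef_xi_ge0.
by rewrite coef_deriv mulr1n coef_xi_gt0.
Qed.

(* Coefficients of index [k > N] satisfy c_k <= k c_k / N, the others
   c_k <= d (k + 1) c_(k+1) with d = (b + N + 1) / (n - N). *)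
Lemma xi_le_deriv (R : realType) (b : R) (n N : nat) (t : R) :
  -1 < b -> (0 < N < n)%N -> 0 <= t ->
  (xi b n).[t] <=
  (t / N%:R + (b + N.+1%:R) / (n - N)%:R) * (xi b n)^`().[t].
Proof.
move=> b_gtN1 /andP[N0 Nn] t0; set p := xi b n; set d := _ / (n - N)%:R.
have d0 : 0 <= d.
  by rewrite divr_ge0 ?ler0n //; have : 0 <= N%:R :> R by []; rewrite -natr1; lra.
(* [q.[t]] is the right side minus the left; as t >= 0, nonnegative coefficients suffice. The factor
   'X turns the k-th coefficient of the derivative into k c_k. *)
pose q : {poly R} := N%:R^-1 *: ('X * p^`()) + d *: p^`() - p.
suff : 0 <= q.[t] by rewrite /q !hornerE /= mulrDl [t / _]mulrC subr_ge0.
have p'0 k : 0 <= p^`()`_k by rewrite coef_deriv mulrn_wge0 ?coef_xi_ge0.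
have Xp' k : ('X * p^`())`_k = p`_k *+ k.
  by case: k => [|k]; rewrite coefXM ?mulr0n // coef_deriv.
apply: horner_ge0 => // k; rewrite coefB coefD !coefZ Xp'.
have pk0 : 0 <= p`_k by apply: coef_xi_ge0.
case: (leqP k N) => kN; last first.
  have : p`_k <= N%:R^-1 * (p`_k *+ k).
    rewrite -[_ *+ k]mulr_natl mulrA ler_peMl // mulrC ler_pdivlMr ?ltr0n //.
    by rewrite mul1r ler_nat ltnW.
  have := mulr_ge0 d0 (p'0 k); lra.
have kn := leq_ltn_trans kN Nn.
have : p`_k <= d * p^`()`_k.
  rewrite {1}/p coef_xi_step // ler_wpM2r //.
  (* (b + k + 1) / (n - k) increases with k, and its value at k = N is d. *)
  apply: ler_pM; rewrite ?invr_ge0 ?ler0n //.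
  - by have : 0 <= k%:R :> R by []; rewrite -natr1; lra.
  - by rewrite lerD2l ler_nat ltnS.
  - by rewrite lef_pV2 ?posrE ?ltr0n ?subn_gt0 // ler_nat leq_sub2l.
have : 0 <= N%:R^-1 * (p`_k *+ k) by rewrite mulr_ge0 ?invr_ge0 ?mulrn_wge0.
lra.
Qed.

Lemma xi_div_deriv_cvg0 (R : realType) (b : R) (t : R) :
  -1 < b -> 0 < t ->
  (xi b n).[t] / (xi b n)^`().[t] @[n --> \oo] --> 0.
Proof.
move=> b_gtN1 t0; apply/cvgr0Pnorm_le => e e0.
have e2 : 0 < e / 2 by rewrite divr_gt0.
(* N depends on t and e only and makes the first term of [xi_le_deriv] at most e / 2; the second is
   then at most e / 2 for n large. *)
pose N := (Num.truncn (t / (e / 2))).+1.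
have tN : t / N%:R <= e / 2.
  rewrite ler_pdivrMr ?ltr0n // mulrC -ler_pdivrMr // ltW //.
  exact: truncnS_gt.
near=> n.
have Nn : (N < n)%N by near: n; exact: nbhs_infty_gt.
have n0 : (0 < n)%N by apply: leq_ltn_trans Nn.
have D0 : 0 < (xi b n)^`().[t] by rewrite deriv_xi_gt0 // ltW.
rewrite ger0_norm; last first.
  rewrite divr_ge0 ?(ltW D0) // horner_ge0 ?(ltW t0) // => k.
  exact: coef_xi_ge0.
rewrite ler_pdivrMr //.
apply: le_trans (xi_le_deriv _ _ n N _ b_gtN1 _ (ltW t0)) _; first by rewrite Nn.
rewrite ler_wpM2r ?(ltW D0) // [leRHS]splitr lerD //.
rewrite ler_pdivrMr ?ltr0n ?subn_gt0 // mulrC -ler_pdivrMr // natrB ?(ltnW Nn)//.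
rewrite lerBrDr ltW //.
by near: n; exact: nbhs_infty_gtr.
Unshelve. all: by end_near. Qed.

(** * Zeros of [xi] and pointwise limit of the exceptional polynomials *)

Lemma xi_neg_root (R : realType) (b : R) (n : nat) (x : R) :
  -1 < b -> root (xi b n) x -> x < 0.
Proof.
move=> b_gtN1; rewrite ltNge => /rootP xi0; apply/negP => x0.
have := horner_gt0 _ (xi b n) x (fun k => coef_xi_ge0 _ _ n k b_gtN1)
  (coef_xi_gt0 _ _ n 0 b_gtN1 isT) x0.
by rewrite xi0 ltxx.
Qed.

(** The chain rule for p(- x) turns the minus sign of [xlaguerreIE] into a plus. *)
Lemma horner_xlaguerreI (R : realType) (a : R) (m j : nat) (x : R) :
  (xlaguerreI a m j).[x] =
  (xi a m).[x] * (xi (a - 1) j).[- x]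
  + (xi (a - 1) m).[x] * (xi (a - 1) j)^`().[- x].
Proof.
rewrite xlaguerreIE.
have -> : laguerre (a - 1) j = xi (a - 1) j \Po (- 'X).
  by rewrite /xi -comp_polyA rmorphN /= comp_polyX opprK comp_polyXr.
rewrite deriv_comp derivN derivX !hornerE !horner_comp !hornerE.
rewrite /=; ring.
Qed.

Lemma xlaguerreI_cvg (R : realType) (a : R) (m : nat) (x : R) :
  0 < a -> x < 0 ->
  (xlaguerreI a m j).[x] / (xi (a - 1) j)^`().[- x] @[j --> \oo]
    --> (xi (a - 1) m).[x].
Proof.
move=> a0 x0; have b_gtN1 : -1 < a - 1 by lra.
have Nx0 : 0 < - x by lra.
have : (xi a m).[x] * ((xi (a - 1) j).[- x] / (xi (a - 1) j)^`().[- x])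
    + (xi (a - 1) m).[x] @[j --> \oo] --> (xi (a - 1) m).[x].
  rewrite -[X in _ --> X]add0r -[0 in X in _ --> X](mulr0 (xi a m).[x]).
  apply: cvgD; last exact: cvg_cst.
  by apply: cvgM; [exact: cvg_cst | exact: xi_div_deriv_cvg0].
apply: cvg_trans; apply: near_eq_cvg.
near=> j; rewrite horner_xlaguerreI mulrDl !mulrA mulfK //.
(* At j = 0 the derivative vanishes, so the division cancels only for j > 0. *)
rewrite gt_eqF // deriv_xi_gt0 //; last lra.
by near: j; exact: nbhs_infty_gt.
Unshelve. all: by end_near. Qed.

(** * Real roots and their indexing *)

Lemma poly_sign_change_root (R : realType) (p : {poly R}) (u v : R) :
  u <= v -> p.[u] * p.[v] < 0 -> exists2 x, u < x < v & root p x.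
Proof.
move=> uv puv.
have [x /andP[ux xv] px] : exists2 x, u <= x <= v & root p x.
  case: (lerP 0 p.[u]) => pu.
    have [||x xuv] := @poly_ivt R (- p) u v => //; last by rewrite rootN; exists x.
    by rewrite !hornerN oppr_le0 pu oppr_ge0 leNgt; apply/negP => pv; nra.
  by apply: poly_ivt => //; rewrite (ltW pu) leNgt; apply/negP => pv; nra.
have px0 := rootP px.
(* The root is not an endpoint, as the product of the end values is nonzero. *)
exists x => //; rewrite !lt_neqAle ux xv !andbT.
by apply/andP; split; [apply: contraTneq puv => -> | apply: contraTneq puv => <-];
  rewrite px0 ?mul0r ?mulr0 ltxx.
Qed.

(** A polynomial of degree m with m distinct roots splits into distinct linear factors; this makes
    the zeros w_i simple. *)
Lemma increasing_enum_factor (R : realType) (m : nat) (p : {poly R})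
    (w : 'I_m -> R) :
  size p = m.+1 -> increasing_enum [set x | root p x] w ->
  p = lead_coef p *: \prod_(i < m) ('X - (w i)%:P).
Proof.
move=> sp [w_inc w_range].
rewrite {1}(@all_roots_prod_XsubC _ p [seq w i | i <- enum 'I_m]).
- by rewrite big_map big_enum.
- by rewrite size_map size_enum_ord.
- by apply/allP => _ /mapP[i _ ->]; have : range w (w i) by []; rewrite w_range.
- rewrite uniq_rootsE map_inj_uniq ?enum_uniq // => i k wik.
  apply/val_inj; case: (ltngtP i k) => // /w_inc; by rewrite wik ltxx.
Qed.

(** A finite chain has no order automorphism but the identity. This will show that the root found
    near w_i is the i-th one. *)
Lemma increasing_ord_id (m : nat) (f : 'I_m -> 'I_m) :
  {homo f : i k / (i < k)%N} -> f =1 id.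
Proof.
move=> f_inc; apply: Order.mono_unique => //.
  by move=> i k; exact: leq_total.
by apply: le_mono => i k; exact: f_inc.
Qed.

(** * Convergence of the zeros *)

Theorem proposition3p4 (R : realType) (a : R) (m : nat)
    (y : nat -> 'I_m -> R) (w : 'I_m -> R) :
  0 < a ->
  (forall j : nat,
     increasing_enum [set x : R | x < 0 /\ root (xlaguerreI a m j) x] (y j)) ->
  increasing_enum [set x : R | root (laguerre (a - 1) m \Po (- 'X)) x] w ->
  forall i : 'I_m, y j i @[j --> \oo] --> w i.
Proof.
move=> a0 y_enum w_enum; have b_gtN1 : -1 < a - 1 by lra.
set q := xi (a - 1) m.
have q_factor := increasing_enum_factor _ _ q w (size_xi _ _ m b_gtN1) w_enum.
have [w_inc w_range] := w_enum.
have w_neg i : w i < 0.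
  apply: (xi_neg_root _ (a - 1) m _ b_gtN1).
  by have : range w (w i) by []; rewrite w_range.
(* It is enough to treat radii so small that the intervals around the w_i are negative and disjoint;
   any other radius is replaced by a smaller d. *)
suff close (e : R) : 0 < e -> (forall i, w i + e < 0) ->
    (forall i k : 'I_m, (i < k)%N -> w i + e < w k - e) ->
    \forall j \near \oo, forall i, `|w i - y j i| < e.
  move=> i; apply/cvgrPdist_lt => e e0.
  have [d [d0 de d_neg d_sep]] : exists d, [/\ 0 < d, d < e,
      (forall i, w i + d < 0) &
      (forall i k : 'I_m, (i < k)%N -> w i + d < w k - d)].
    near (0 : R)^'+ => d; exists d; split.
    - by [].
    - by near: d; exact: nbhs_right_lt.
    - near: d; apply: filter_forall => k; near=> d.
      rewrite -ltrBrDl sub0r; near: d; apply: nbhs_right_lt.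
      by rewrite oppr_gt0.
    - near: d; apply: filter_forall => k; apply: filter_forall => l.
      case: (ltnP k l) => [/w_inc wkl|_]; last by near=> d.
      have wkl2 : 0 < (w l - w k) / 2 by lra.
      near=> d => _; suff : d < (w l - w k) / 2 by lra.
      by near: d; exact: nbhs_right_lt.
  near=> j; have : forall i, `|w i - y j i| < d.
    by near: j; exact: close.
  by move=> /(_ i) /lt_trans; exact.
move=> e0 e_neg e_sep.
have q_change i : q.[w i - e] * q.[w i + e] < 0.
  have qE x : q.[x] = lead_coef q * \prod_k (x - w k).
    rewrite {1}q_factor hornerZ horner_prod; congr (_ * _).
    by apply: eq_bigr => k _; rewrite !hornerE.
  rewrite !qE mulrACA -big_split /= pmulr_rlt0; last first.
    by rewrite -expr2 exprn_even_gt0 //= lead_coef_eq0 -size_poly_eq0 size_xi.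
  (* The factor of index i is - e^2; for k != i, w_k lies outside the interval around w_i, so both
     differences have the same sign. *)
  rewrite (bigD1 i) //= pmulr_llt0; first nra.
  apply: prodr_gt0 => k; case: (ltngtP k i) => // [/e_sep|/e_sep|/val_inj ->];
    by rewrite ?eqxx //; nra.
have X_change i : \forall j \near \oo,
    (xlaguerreI a m j).[w i - e] * (xlaguerreI a m j).[w i + e] < 0.
  have wm : w i - e < 0 by have := w_neg i; lra.
  have X_cvg := cvgM (xlaguerreI_cvg _ _ m _ a0 wm)
    (xlaguerreI_cvg _ _ m _ a0 (e_neg i)).
  have X_lt := cvgr_lt _ (X_cvg _) _ (q_change i).
  near=> j; have j0 : (0 < j)%N by near: j; exact: nbhs_infty_gt.
  (* Both denominators are positive, so the sign of the product is unchanged. *)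
  suff : (xlaguerreI a m j).[w i - e] / (xi (a - 1) j)^`().[- (w i - e)] *
      ((xlaguerreI a m j).[w i + e] / (xi (a - 1) j)^`().[- (w i + e)]) < 0.
    rewrite mulrACA -invfM pmulr_llt0 // invr_gt0.
    by have := e_neg i => ?; rewrite mulr_gt0 // deriv_xi_gt0 //; lra.
  by near: j; exact: X_lt.
apply: filterS (filter_forall _ X_change) => j Xj i.
have [y_inc y_range] := y_enum j.
have near_root k : exists l, w k - e < y j l < w k + e.
  have [|x /andP[kx xk] x_root] :=
    poly_sign_change_root _ _ _ _ _ (Xj k); first lra.
  have : range (y j) x.
    by rewrite y_range; split => //; apply: lt_trans xk (e_neg k).
  by case=> l _ yl; exists l; rewrite yl; apply/andP.
have [f fP] := choice near_root.
(* If k < l but f l <= f k, the root in the interval around w_l would not exceed the one around w_k,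
   against the separation of the intervals. *)
have f_id : f =1 id.
  apply: increasing_ord_id => k l kl; rewrite ltnNge; apply/negP => flk.
  have ylk : y j (f l) <= y j (f k).
    by move: flk; rewrite leq_eqVlt => /orP[/eqP/val_inj ->|/y_inc/ltW].
  have /andP[_ fk] := fP k; have /andP[fl _] := fP l.
  by have := e_sep _ _ kl; lra.
have := fP i; rewrite f_id => /andP[? ?].
by rewrite ltr_distlC; lra.
Unshelve. all: by end_near. Qed.
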